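(* Let $S\in \mathrm{Sym}^2\mathfrak n$. The left-invariant symmetric $2$-tensor on $N$ defined by $S$ is a Killing tensor if and only if both of the following hold: (i) $[Sx,y]=[x,Sy]$ for all $x,y\in \mathfrak v$; (ii) for every $x\in\mathfrak v$, the map $\mathrm{ad}_x\circ S|_{\mathfrak z}:\mathfrak z\to\mathfrak z$ is skew-symmetric (with respect to $g$).
   Context: $\mathfrak n$ is a finite-dimensional real $2$-step nilpotent Lie algebra (non-abelian, with $[[\mathfrak n,\mathfrak n],\mathfrak n]=0$) with an inner product $g$; $N$ is the connected and simply connected Lie group with Lie algebra $\mathfrak n$, endowed with the left-invariant Riemannian metric (also denoted $g$) defined by $g$; $\nabla$ is its Levi-Civita connection. $\mathfrak z$ is the center of $\mathfrak n$ and $\mathfrak v=\mathfrak z^\perp$, so $\mathfrak n=\mathfrak v\oplus\mathfrak z$ orthogonally. Elements of $\mathrm{Sym}^2\mathfrak n$ are identified with $g$-symmetric endomorphisms of $\mathfrak n$ (equivalently symmetric bilinear forms, via $S(x,y)=g(Sx,y)$), and with left-invariant symmetric $2$-tensor fields on $N$ (the tensor field whose value at the identity is $S$). A symmetric $2$-tensor field $S$ on a Riemannian manifold is a Killing tensor if $(\nabla_XS)(X,X)=0$ for every vector field $X$. *)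

(* Defs.v *)
From HB Require Import structures.
From mathcomp Require Import all_boot all_order all_algebra.
From mathcomp Require Import all_classical all_reals all_analysis.

Set Implicit Arguments.
Unset Strict Implicit.
Unset Printing Implicit Defensive.

Import Order.TTheory GRing.Theory Num.Theory.
Import numFieldNormedType.Exports.

Local Open Scope classical_set_scope.
Local Open Scope ring_scope.

Section LieAlgebra.
Variables (R : realType) (n : nat).
Local Notation V := 'rV[R]_n.

Record two_step_nilpotent (br : {bilinear V -> V -> V}) : Prop := {
  tsn_alternating : forall x, br x x = 0;
  tsn_jacobi : forall x y z,
    br x (br y z) + br y (br z x) + br z (br x y) = 0;
  tsn_nonabelian : exists x y, br x y != 0;
  tsn_two_step : forall x y z, br (br x y) z = 0
}.

Definition lie_center (br : V -> V -> V) : set V :=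
  [set z | forall x, br z x = 0].

Definition orth_compl (g : V -> V -> R) (A : set V) : set V :=
  [set x | forall z, A z -> g x z = 0].

Definition self_adjoint (g : V -> V -> R) (S : V -> V) : Prop :=
  forall x y, g (S x) y = g x (S y).

End LieAlgebra.

Section Calculus.
Variables (R : realType) (n : nat).
Local Notation V := 'rV[R]_n.

Fixpoint of_class_C (k : nat) (W : normedModType R) (f : V -> W) : Prop :=
  match k with
  | 0%N => continuous f
  | k'.+1 => (forall p, differentiable f p) /\
             (forall v, of_class_C k' ('D_v f))
  end.

Definition smooth (W : normedModType R) (f : V -> W) : Prop :=
  forall k, of_class_C k f.

(* The manifold is V itself with its global chart, so every tangent space is V:
   a vector field is a map V -> V, and a covariant 2-tensor field T is a map
   sending a point p to the form T p on the tangent space at p. *)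
Definition tensor2 := V -> V -> V -> R.

Definition dfun (X : V -> V) (f : V -> R) : V -> R := fun p => 'D_(X p) f p.

Definition lie_bracket (X Y : V -> V) : V -> V :=
  fun p => 'D_(X p) Y p - 'D_(Y p) X p.

Definition eval2 (T : tensor2) (X Y : V -> V) : V -> R :=
  fun p => T p (X p) (Y p).

Record affine_connection (nabla : (V -> V) -> (V -> V) -> V -> V) : Prop := {
  conn_smooth : forall X Y, smooth X -> smooth Y -> smooth (nabla X Y);
  conn_addl : forall X X' Y, smooth X -> smooth X' -> smooth Y ->
    forall p, nabla (X \+ X') Y p = nabla X Y p + nabla X' Y p;
  conn_scalel : forall (f : V -> R) X Y, smooth f -> smooth X -> smooth Y ->
    forall p, nabla (fun q => f q *: X q) Y p = f p *: nabla X Y p;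
  conn_addr : forall X Y Y', smooth X -> smooth Y -> smooth Y' ->
    forall p, nabla X (Y \+ Y') p = nabla X Y p + nabla X Y' p;
  conn_leibniz : forall (f : V -> R) X Y, smooth f -> smooth X -> smooth Y ->
    forall p, nabla X (fun q => f q *: Y q) p
              = dfun X f p *: Y p + f p *: nabla X Y p
}.

Record levi_civita (h : tensor2) (nabla : (V -> V) -> (V -> V) -> V -> V) :
    Prop := {
  lc_connection : affine_connection nabla;
  lc_torsion_free : forall X Y, smooth X -> smooth Y ->
    forall p, nabla X Y p - nabla Y X p = lie_bracket X Y p;
  lc_metric : forall X Y Z, smooth X -> smooth Y -> smooth Z ->
    forall p, dfun X (eval2 h Y Z) p
              = eval2 h (nabla X Y) Z p + eval2 h Y (nabla X Z) p
}.

Definition cov_deriv (nabla : (V -> V) -> (V -> V) -> V -> V) (T : tensor2)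
    (X Y Z : V -> V) : V -> R :=
  fun p => dfun X (eval2 T Y Z) p
           - eval2 T (nabla X Y) Z p - eval2 T Y (nabla X Z) p.

Definition killing_tensor (nabla : (V -> V) -> (V -> V) -> V -> V)
    (T : tensor2) : Prop :=
  forall X, smooth X -> forall p, cov_deriv nabla T X X X p = 0.

End Calculus.

Section Affine.
Variables (R : realType) (n : nat).
Local Notation V := 'rV[R]_n.

Lemma linear_continuous_rV (f : {linear V -> V}) : continuous f.
Proof.
have fE q : f q = \sum_(i < n) q ord0 i *: f (delta_mx 0 i).
  rewrite [in LHS](row_sum_delta q) linear_sum.
  by apply: eq_bigr => i _; rewrite linearZ.
have -> : (f : V -> V) = fun q => \sum_(i < n) q ord0 i *: f (delta_mx 0 i).
  exact/funext.
have cadd : continuous (fun x : V * V => x.1 + x.2).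
  by move=> [x y]; apply: cvgD; [exact: cvg_fst|exact: cvg_snd].
have := @continuous_big V 'I_n +%R 0 xpredT cadd V (index_enum 'I_n)
  (fun i q => q ord0 i *: f (delta_mx 0 i)).
apply=> i _ q; apply: cvgZr_tmp; first exact: (nbhs_filter q).
exact: (@coord_continuous R 1 n ord0 i q).
Qed.

Lemma is_diff_affine_rV (c : V) (f : V -> V) p :
  linear f -> is_diff p (fun q => c + f q) f.
Proof.
move=> flin; pose fl := GRing.isLinear.Build _ _ _ _ f flin.
pose fL : {linear V -> V} := HB.pack f fl.
have fc := @linear_continuous_rV fL.
have df : is_diff p f f.
  by apply: DiffDef; [exact: (linear_differentiable (f := fL))
                     |exact: (diff_lin (f := fL))].
rewrite -[X in is_diff _ _ X]add0r; exact: (is_diffD (is_diff_cst c p) df).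
Qed.

End Affine.

(* Realisation of the simply connected Lie group: for a 2-step nilpotent Lie
   algebra the exponential map is a global diffeomorphism, and in exponential
   coordinates the Baker-Campbell-Hausdorff formula gives the product
   p q = p + q + [p, q] / 2, with neutral element 0 and inverse - p. *)
Section NilpotentGroup.
Variables (R : realType) (n : nat).
Variable br : {bilinear 'rV[R]_n -> 'rV[R]_n -> 'rV[R]_n}.
Local Notation V := 'rV[R]_n.

Definition nmul (p q : V) : V := p + q + 2^-1 *: br p q.

(* Left-invariant field with value x at the identity. *)
Definition left_inv_field (x : V) : V -> V := fun p => 'd (nmul p) 0 x.

(* Tensor field whose value at p is the pullback of the form B on the tangent
   space at the identity by left translation by the inverse of p. *)
Definition left_inv_tensor (B : V -> V -> R) : tensor2 R n :=
  fun p u v => B ('d (nmul (- p)) p u) ('d (nmul (- p)) p v).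

Lemma nmul0l p : nmul 0 p = p.
Proof. by rewrite /nmul linear0l scaler0 addr0 add0r. Qed.

Lemma nmul0r p : nmul p 0 = p.
Proof. by rewrite /nmul linear0r scaler0 !addr0. Qed.

Lemma is_diff_nmul p q : is_diff q (nmul p) (fun v => v + 2^-1 *: br p v).
Proof.
have -> : nmul p = fun r => p + (r + 2^-1 *: br p r).
  by apply/funext => r; rewrite /nmul addrA.
apply: is_diff_affine_rV => a u v.
rewrite linearDr linearZr_LR /= scalerDr scalerA mulrC -scalerA scalerDr.
by rewrite addrACA.
Qed.

Lemma left_inv_fieldE x : left_inv_field x = fun p => x + 2^-1 *: br p x.
Proof.
by apply/funext => p; rewrite /left_inv_field; case: (is_diff_nmul p 0) => _ ->.
Qed.

Lemma left_inv_tensorE B p u v : left_inv_tensor B p u v =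
  B (u - 2^-1 *: br p u) (v - 2^-1 *: br p v).
Proof.
rewrite /left_inv_tensor; case: (is_diff_nmul (- p) p) => _ ->.
by rewrite !linearNl !scalerN.
Qed.

Lemma derive_left_inv_field x p v : 'D_v (left_inv_field x) p = 2^-1 *: br v x.
Proof.
have dX : is_diff p (left_inv_field x) (fun v => 2^-1 *: br v x).
  rewrite left_inv_fieldE; apply: is_diff_affine_rV => a u w.
  by rewrite linearDl linearZl_LR /= scalerDr scalerA mulrC -scalerA.
by case: dX => dX E; rewrite deriveE // E.
Qed.

Hypothesis nil : two_step_nilpotent br.

Lemma nmulNl p : nmul (- p) p = 0.
Proof.
by rewrite /nmul linearNl (tsn_alternating nil) oppr0 scaler0 addr0 addNr.
Qed.

Lemma brC x y : br x y = - br y x.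
Proof.
have := tsn_alternating nil (x + y).
rewrite linearDl !linearDr !(tsn_alternating nil) add0r addr0.
by move=> /eqP; rewrite addr_eq0 => /eqP.
Qed.

Lemma br_brr x y z : br x (br y z) = 0.
Proof. by rewrite brC (tsn_two_step nil) oppr0. Qed.

Lemma nmulA p q r : nmul p (nmul q r) = nmul (nmul p q) r.
Proof.
rewrite /nmul !(linearDl, linearDr) !linearZl_LR !linearZr_LR /=.
rewrite br_brr (tsn_two_step nil) !scaler0 !addr0 !scalerDr -!addrA.
do 2!congr (_ + _).
by rewrite [RHS]addrCA; congr (_ + _); rewrite [LHS]addrC -addrA.
Qed.

(* The Lie algebra of the group is the given one. *)
Lemma lie_bracket_left_inv x y :
  lie_bracket (left_inv_field x) (left_inv_field y) = left_inv_field (br x y).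
Proof.
apply/funext => p; rewrite /lie_bracket !derive_left_inv_field !left_inv_fieldE.
rewrite !linearDl !linearZl_LR /= !(tsn_two_step nil) !scaler0 !addr0.
rewrite br_brr scaler0 addr0 (brC y x) scalerN opprK.
by rewrite -scalerDl -div1r -splitr scale1r.
Qed.

Lemma left_inv_tensor_left_inv B x y p :
  left_inv_tensor B p (left_inv_field x p) (left_inv_field y p) = B x y.
Proof.
rewrite left_inv_tensorE !left_inv_fieldE !linearDr !linearZr_LR /=.
by rewrite !br_brr !scaler0 !addr0 !addrK.
Qed.

End NilpotentGroup.

(* Main.v *)
(* Expanding a vector field in the left-invariant frame shows that
   (nabla_X T)(X, X) depends only on the value of X at the point, so X may be
   taken left-invariant. For E left-invariant with value x, Koszul's formula
   reads g (nabla_E E, y) = - g (x, [x, y]), whence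
   (nabla_E T)(E, E) = 2 g (x, [x, S x]): the tensor is Killing if and only if
   this cubic form vanishes. On x = v + z with v in the orthogonal complement of
   the center and z central it equals g (z, [v, S v]) + g (z, [v, S z]), whose
   terms are linear and quadratic in z, so both vanish. Polarizing [v, S v] = 0
   in v gives the first condition, and polarizing g (z, [v, S z]) = 0 in z the
   second. *)
From HB Require Import structures.
Require Import Defs.
From mathcomp Require Import all_boot all_order all_algebra.
From mathcomp Require Import all_classical all_reals all_analysis.
From mathcomp Require Import lra.
Import numFieldNormedType.Exports.
Local Open Scope ring_scope.

Set Implicit Arguments.
Unset Strict Implicit.
Unset Printing Implicit Defensive.

Import Order.TTheory GRing.Theory Num.Theory.

Local Open Scope classical_set_scope.

(** * Product rule for continuous bilinear maps *)

Section BilinearDerivative.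
Variables (R : realType) (U W Z V : normedModType R) (B : U -> W -> Z).
Hypothesis Bl : forall w, linear (B^~ w).
Hypothesis Br : forall u, linear (B u).
Hypothesis Bc : continuous (fun p => B p.1 p.2).

Lemma is_diff_bilinear (f : V -> U) (h : V -> W) p :
  differentiable f p -> differentiable h p ->
  is_diff p (fun q => B (f q) (h q))
    (fun v => B (f p) ('d h p v) + B ('d f p v) (h p)).
Proof.
move=> df dh.
pose bB := @bilinear_isBilinear.Build R U W Z *:%R *:%R B (conj Bl Br).
pose b : {bilinear U -> W -> Z} := HB.pack B bB.
have db := differentiable_bilin (f := b) _ Bc.
have -> : (fun q => B (f q) (h q)) =
          (fun r => b r.1 r.2) \o (fun q => (f q, h q)) by [].
have dfh := differentiable_pair df dh.
apply: DiffDef; first exact: differentiable_comp.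
by rewrite diff_comp //= (@diff_bilin _ _ _ _ b) // diff_pair.
Qed.

Lemma differentiable_bilinear (f : V -> U) (h : V -> W) p :
  differentiable f p -> differentiable h p ->
  differentiable (fun q => B (f q) (h q)) p.
Proof. by move=> df dh; case: (is_diff_bilinear df dh). Qed.

Lemma derive_bilinear (f : V -> U) (h : V -> W) p v :
  differentiable f p -> differentiable h p ->
  'D_v (fun q => B (f q) (h q)) p = B (f p) ('D_v h p) + B ('D_v f p) (h p).
Proof.
move=> df dh; case: (is_diff_bilinear df dh) => dB E.
by rewrite !deriveE // E.
Qed.

End BilinearDerivative.

(** * Closure properties of smooth maps, and derivatives in coordinates *)

Section Smooth.
Variables (R : realType) (n : nat).
Local Notation V := 'rV[R]_n.
Implicit Types (W : normedModType R) (k : nat).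

Lemma smooth_differentiable W (f : V -> W) p : smooth f -> differentiable f p.
Proof. by move=> /(_ 1%N) [+ _]; apply. Qed.

Lemma of_class_CW k W (f : V -> W) : of_class_C k.+1 f -> of_class_C k f.
Proof.
elim: k f => [|k IH] f [df Df].
  by move=> p; exact: differentiable_continuous.
by split=> // v; apply: IH; exact: Df.
Qed.

Lemma of_class_C_cst k W (w : W) : of_class_C k (fun _ : V => w).
Proof.
elim: k w => [|k IH] w /=; first exact: cst_continuous.
split=> [p|v]; first exact: differentiable_cst.
have -> : 'D_v (fun _ : V => w) = fun _ => 0; last exact: IH.
by apply/funext => p; exact: derive_cst.
Qed.

Lemma of_class_C_id k : of_class_C k (fun q : V => q).
Proof.
case: k => [|k] /=; first by move=> p; exact: cvg_id.
split=> [p|v]; first by case: (is_diff_id p).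
have -> : 'D_v (fun q : V => q) = fun _ => v; last exact: of_class_C_cst.
by apply/funext => p; exact: derive_id.
Qed.

Lemma of_class_CD k W (f h : V -> W) : of_class_C k f -> of_class_C k h ->
  of_class_C k (fun q => f q + h q).
Proof.
elim: k f h => [|k IH] f h /=.
  by move=> fc hc p; exact: (cvgD (fc p) (hc p)).
move=> [df Df] [dh Dh]; split=> [p|v]; first exact: differentiableD.
have -> : 'D_v (fun q => f q + h q) = fun q => 'D_v f q + 'D_v h q.
  by apply/funext => p; apply: deriveD; exact: diff_derivable.
by apply: IH.
Qed.

(** By induction on [k]: the derivative of the product is a sum of two products of the same shape,
    in which one factor is differentiated and the other is kept, its class lowered by
    [of_class_CW]. *)
Lemma of_class_C_bilinear k (U1 U2 : normedModType R) W (B : U1 -> U2 -> W)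
    (f : V -> U1) (h : V -> U2) :
  (forall w, linear (B^~ w)) -> (forall u, linear (B u)) ->
  continuous (fun p => B p.1 p.2) ->
  of_class_C k f -> of_class_C k h -> of_class_C k (fun q => B (f q) (h q)).
Proof.
move=> Bl Br Bc; elim: k f h => [|k IH] f h.
  move=> fc hc p.
  exact: (cvg_comp2 (fc p) (hc p) (Bc (f p, h p))).
move=> Cf Ch; have [df Df] := Cf; have [dh Dh] := Ch.
split=> [p|v]; first exact: (differentiable_bilinear Bl Br Bc).
have -> : 'D_v (fun q => B (f q) (h q)) =
    fun q => B (f q) ('D_v h q) + B ('D_v f q) (h q).
  by apply/funext => p; exact: (derive_bilinear Bl Br Bc).
by apply: of_class_CD; apply: IH; [exact: of_class_CW|exact: Dh|exact: Df|exact: of_class_CW].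
Qed.

Lemma smooth_cst W (w : W) : smooth (fun _ : V => w).
Proof. by move=> k; exact: of_class_C_cst. Qed.

Lemma smooth_id : smooth (fun q : V => q).
Proof. by move=> k; exact: of_class_C_id. Qed.

Lemma smoothD W (f h : V -> W) : smooth f -> smooth h ->
  smooth (fun q => f q + h q).
Proof. by move=> sf sh k; exact: of_class_CD. Qed.

Lemma smooth_bilinear (U1 U2 : normedModType R) W (B : U1 -> U2 -> W) (f : V -> U1) (h : V -> U2) :
  (forall w, linear (B^~ w)) -> (forall u, linear (B u)) ->
  continuous (fun p => B p.1 p.2) ->
  smooth f -> smooth h -> smooth (fun q => B (f q) (h q)).
Proof. by move=> Bl Br Bc sf sh k; exact: of_class_C_bilinear. Qed.

Lemma smoothZ W (c : V -> R) (f : V -> W) : smooth c -> smooth f ->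
  smooth (fun q => c q *: f q).
Proof.
apply: (smooth_bilinear (U1 := R) (B := *:%R)).
- by move=> w a x y; rewrite scalerDl scalerA.
- by move=> u a x y; rewrite scalerDr !scalerA mulrC.
- exact: scale_continuous.
Qed.

Lemma smooth_sum W (I : Type) (r : seq I) (F : I -> V -> W) :
  (forall i, smooth (F i)) -> smooth (fun q => \sum_(i <- r) F i q).
Proof.
move=> sF; elim: r => [|i r IH].
  have -> : (fun q => \sum_(i <- [::]) F i q) = fun _ => 0.
    by apply/funext => q; rewrite big_nil.
  exact: smooth_cst.
have -> : (fun q => \sum_(j <- i :: r) F j q) =
          fun q => F i q + \sum_(j <- r) F j q.
  by apply/funext => q; rewrite big_cons.
exact: smoothD.
Qed.

(** On row vectors [B] is a finite sum of fixed vectors, its values on pairs of basis vectors,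
    weighted by products of coordinates. *)
Lemma bilinear_continuous_rV W (B : V -> V -> W) :
  (forall w, linear (B^~ w)) -> (forall u, linear (B u)) ->
  continuous (fun p => B p.1 p.2).
Proof.
move=> Bl Br.
pose bB := @bilinear_isBilinear.Build R V V W *:%R *:%R B (conj Bl Br).
pose b : {bilinear V -> V -> W} := HB.pack B bB.
have -> : (fun p => B p.1 p.2) = fun p => \sum_(i < n) \sum_(j < n)
    (p.1 0 i * p.2 0 j) *: B (delta_mx 0 i) (delta_mx 0 j).
  apply/funext => -[x y] /=; rewrite -[B]/(b : V -> V -> W).
  rewrite {1}(row_sum_delta x) {1}(row_sum_delta y) linear_sumlz.
  apply: eq_bigr => i _; rewrite linearZl_LR linear_sumr scaler_sumr.
  by apply: eq_bigr => j _; rewrite linearZr_LR /= scalerA.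
have cadd : continuous (fun x : W * W => x.1 + x.2) by exact: add_continuous.
apply: (continuous_big cadd) => i _; apply: (continuous_big cadd) => j _ p.
apply: cvgZr_tmp; apply: cvgM.
- exact: (cvg_comp _ _ (@cvg_fst _ _ (nbhs p.1) (nbhs p.2) _)
           (@coord_continuous R 1 n 0 i p.1)).
- exact: (cvg_comp _ _ (@cvg_snd _ _ (nbhs p.1) (nbhs p.2) _)
           (@coord_continuous R 1 n 0 j p.2)).
Qed.

Lemma smooth_bilinear_rV W (B : V -> V -> W) (f h : V -> V) :
  (forall w, linear (B^~ w)) -> (forall u, linear (B u)) ->
  smooth f -> smooth h -> smooth (fun q => B (f q) (h q)).
Proof.
by move=> Bl Br; apply: smooth_bilinear => //; exact: bilinear_continuous_rV.
Qed.

Lemma derive_bilinear_rV W (B : V -> V -> W) (f h : V -> V) p v :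
  (forall w, linear (B^~ w)) -> (forall u, linear (B u)) ->
  smooth f -> smooth h ->
  'D_v (fun q => B (f q) (h q)) p = B (f p) ('D_v h p) + B ('D_v f p) (h p).
Proof.
move=> Bl Br sf sh; apply: derive_bilinear => //.
- exact: bilinear_continuous_rV.
- exact: smooth_differentiable.
- exact: smooth_differentiable.
Qed.

Lemma derive_coord (f : V -> V) (i : 'I_n) p v : smooth f ->
  'D_v (fun q => f q 0 i) p = 'D_v f p 0 i.
Proof.
move=> sf; rewrite derive_mx ?mxE //.
by apply: diff_derivable; exact: smooth_differentiable.
Qed.

Lemma smooth_coord (f : V -> V) (i : 'I_n) :
  smooth f -> smooth (fun q => f q 0 i).
Proof.
move=> sf k; elim: k f sf => [|k IH] f sf.
  move=> p.
  exact: (cvg_comp _ _ (sf 0%N p) (@coord_continuous R 1 n 0 i (f p))).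
split=> [p|v].
  apply: (differentiable_comp (g := fun x : V => x 0 i)).
    exact: smooth_differentiable.
  exact: differentiable_coord.
have -> : 'D_v (fun q => f q 0 i) = fun q => 'D_v f q 0 i.
  by apply/funext => p; exact: derive_coord.
(* Smoothness passes to the directional derivative: its class [m] is read off class [m.+1] of
   [f]. *)
by apply: IH => m; have [_ +] := sf m.+1; apply.
Qed.

End Smooth.

(** * Orthogonal decomposition along the center, and the algebraic form of the Killing condition *)

Section DotProduct.
Variables (R : realType) (n : nat) (g : {dot 'rV[R]_n for idfun}).
Local Notation V := 'rV[R]_n.

Lemma dotC x y : g x y = g y x.
Proof. by have /= := hermC g x y; rewrite expr0 mul1r. Qed.

Lemma dot_eq0 x : g x x = 0 -> x = 0.
Proof.
have [//|x0 gx] := eqVneq x 0.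
by have := neq0_dnorm_gt0 (s := g) _ x0; rewrite gx ltxx.
Qed.

Lemma dot_linearl w : linear (g^~ w : V -> R).
Proof. by move=> a x y; rewrite linearDl linearZl. Qed.

Lemma dot_linearr u : linear (g u : V -> R).
Proof. by move=> a x y; rewrite linearDr linearZr. Qed.

Lemma dot_suml (I : Type) (r : seq I) (F : I -> V) y :
  g (\sum_(i <- r) F i) y = \sum_(i <- r) g (F i) y.
Proof. exact: linear_sumlz. Qed.

Lemma dot_mulmxl r (a : 'rV[R]_r) (Z : 'M[R]_(r, n)) y :
  g (a *m Z) y = \sum_i a 0 i * g (row i Z) y.
Proof.
by rewrite mulmx_sum_row dot_suml; apply: eq_bigr => i _; rewrite linearZl.
Qed.

(** Orthogonal projection onto a row space: its coefficients in a basis [Z] solve a linear system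
    whose matrix is the Gram matrix [M] of that basis. *)
Lemma orth_decomp m (A : 'M[R]_(m, n)) u :
  exists2 z, (z <= A)%MS & forall w, (w <= A)%MS -> g (u - z) w = 0.
Proof.
pose Z := row_base A; pose M := \matrix_(i, j) g (row i Z) (row j Z).
have ZM (a : 'rV_(\rank A)) j : g (a *m Z) (row j Z) = (a *m M) 0 j.
  by rewrite dot_mulmxl mxE; apply: eq_bigr => i _; rewrite mxE.
(* If [a *m M = 0], then [a *m Z] is orthogonal to every row of [Z], hence to itself, so it vanishes
   by definiteness; the rows of [Z] being free, [a = 0]. *)
have Munit : M \in unitmx.
  rewrite -row_free_unit; apply/inj_row_free => a aM0.
  have : a *m Z = 0.
    apply: dot_eq0; rewrite dot_mulmxl big1 // => j _.
    by rewrite dotC ZM aM0 mxE mulr0.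
  by move/eqP; rewrite mulmx_free_eq0 ?row_base_free // => /eqP.
pose a := (\row_j g u (row j Z)) *m invmx M.
exists (a *m Z) => [|w]; first by rewrite -(eq_row_base A) submxMl.
rewrite -(eq_row_base A) => /submxP [b ->].
rewrite dotC dot_mulmxl big1 // => j _.
by rewrite dotC linearBl /= ZM mulmxKV // mxE subrr mulr0.
Qed.

Variable br : {bilinear V -> V -> V}.

Lemma lie_center_decomp u : exists v z,
  [/\ u = v + z, orth_compl g (lie_center br) v & lie_center br z].
Proof.
(* The center is presented as a row space: the common kernel of the maps sending [z] to its bracket
   with each basis vector. *)
pose A := (\bigcap_(j < n) kermx (lin1_mx (applyr br (delta_mx 0 j))))%MS.
have AP z : (z <= A)%MS <-> lie_center br z.
  split=> [/sub_bigcapmxP zA x|zc].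
    rewrite (row_sum_delta x) linear_sumr big1 // => j _.
    have /sub_kermxP := zA j isT; rewrite mul_rV_lin1 /= => zj.
    by rewrite linearZr_LR /= zj scaler0.
  apply/sub_bigcapmxP => j _; apply/sub_kermxP.
  by rewrite mul_rV_lin1; exact: zc.
have [z /AP zc zo] := orth_decomp A u.
exists (u - z), z; split=> //; first by rewrite subrK.
by move=> w /AP; exact: zo.
Qed.

Hypothesis nil : two_step_nilpotent br.
Variable S : {linear V -> V}.

Lemma killing_algebraic :
  (forall x, g x (br x (S x)) = 0) <->
  (forall x y, orth_compl g (lie_center br) x ->
     orth_compl g (lie_center br) y -> br (S x) y = br x (S y)) /\
  (forall x, orth_compl g (lie_center br) x ->
     forall z w, lie_center br z -> lie_center br w ->
       g (br x (S z)) w = - g z (br x (S w))).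
Proof.
have brc x y : lie_center br (br x y).
  by move=> z; exact: (tsn_two_step nil).
(* Brackets are central, so [v] is orthogonal to them; and [z], being central, disappears from the
   left slot of the bracket. *)
have split_form v z : orth_compl g (lie_center br) v -> lie_center br z ->
    g (v + z) (br (v + z) (S (v + z))) = g z (br v (S v)) + g z (br v (S z)).
  move=> vo zc; rewrite linearDl /= (vo _ (brc _ _)) add0r.
  by rewrite linearDl /= zc addr0 linearD linearDr linearDr.
split=> [K|[Ki Kii] x]; last first.
  have [v [z [-> vo zc]]] := lie_center_decomp x.
  rewrite split_form //.
  (* The first condition at the pair [v], [v], combined with antisymmetry, makes this bracket equal
     to its own opposite. *)
  have -> : br v (S v) = 0.
    have := Ki v v vo vo; rewrite (brC nil) => /eqP.
    by rewrite eq_sym -addr_eq0 -mulr2n -scaler_nat scaler_eq0 pnatr_eq0 => /eqP.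
  have /eqP := Kii v vo z z zc zc.
  rewrite dotC -addr_eq0 -mulr2n mulrn_eq0 => /eqP ->.
  by rewrite linear0r addr0.
have cN z : lie_center br z -> lie_center br (- z).
  by move=> zc x; rewrite linearNl zc oppr0.
have cD z w : lie_center br z -> lie_center br w -> lie_center br (z + w).
  by move=> zc wc x; rewrite linearDl /= zc wc addr0.
have oD x y : orth_compl g (lie_center br) x ->
    orth_compl g (lie_center br) y -> orth_compl g (lie_center br) (x + y).
  by move=> xo yo z zc; rewrite linearDl /= xo // yo // addr0.
have K0 v z : orth_compl g (lie_center br) v -> lie_center br z ->
    g z (br v (S v)) = 0 /\ g z (br v (S z)) = 0.
  move=> vo zc.
  (* Changing [z] into [- z] flips the linear term and keeps the quadratic one, so the two equations
     separate them. *)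
  have := K (v + z); rewrite split_form // => E1.
  have := K (v - z); rewrite split_form //; last exact: cN.
  rewrite !linearNl /= [S (- _)]linearN [br _ (- _)]linearNr [g _ (- _)]linearNr => E2.
  by split; lra.
have Kv v : orth_compl g (lie_center br) v -> br v (S v) = 0.
  (* As [br v (S v)] is itself central, it may serve as [z]. *)
  by move=> vo; apply: dot_eq0; have [] := K0 _ _ vo (brc v (S v)).
split=> [x y xo yo|x xo z w zc wc].
  (* Polarization at [x + y] leaves only the two cross terms. *)
  have := Kv _ (oD _ _ xo yo).
  rewrite linearD linearDl !linearDr /= !Kv // add0r addr0 => /eqP.
  by rewrite addr_eq0 => /eqP ->; rewrite (brC nil).
have [_] := K0 _ _ xo (cD _ _ zc wc).
rewrite linearD linearDr !linearDl !linearDr /=.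
have [_ ->] := K0 _ _ xo zc; have [_ ->] := K0 _ _ xo wc.
by rewrite add0r addr0 [g _ w]dotC => /eqP; rewrite addrC addr_eq0 => /eqP.
Qed.

End DotProduct.

(** * Additivity of a connection over finite sums of fields *)

Section Connection.
Variables (R : realType) (n : nat).
Local Notation V := 'rV[R]_n.
Variable nabla : (V -> V) -> (V -> V) -> V -> V.
Hypothesis conn : affine_connection nabla.

Lemma conn_suml (I : Type) (r : seq I) (F : I -> V -> V) Y p :
  (forall i, smooth (F i)) -> smooth Y ->
  nabla (fun q => \sum_(i <- r) F i q) Y p = \sum_(i <- r) nabla (F i) Y p.
Proof.
move=> sF sY; elim: r => [|i r IH].
  (* The empty sum is the zero field, obtained as the constant function 0 times a smooth field, so
     that the scaling axiom applies. *)
  have := conn_scalel conn (smooth_cst n (0 : R)) sY sY p.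
  rewrite scale0r => E0; rewrite [RHS]big_nil; rewrite -[RHS]E0.
  by congr (nabla _ _ _); apply/funext => q; rewrite big_nil scale0r.
rewrite big_cons -IH -(conn_addl conn) //; last exact: smooth_sum.
by congr (nabla _ _ _); apply/funext => q; rewrite big_cons.
Qed.

Lemma conn_sumr (I : Type) (r : seq I) (F : I -> V -> V) X p :
  (forall i, smooth (F i)) -> smooth X ->
  nabla X (fun q => \sum_(i <- r) F i q) p = \sum_(i <- r) nabla X (F i) p.
Proof.
move=> sF sX; elim: r => [|i r IH].
  have := conn_leibniz conn (smooth_cst n (0 : R)) sX sX p.
  rewrite scale0r addr0 /dfun derive_cst scale0r => E0; rewrite [RHS]big_nil.
  rewrite -[RHS]E0.
  by congr (nabla _ _ _); apply/funext => q; rewrite big_nil scale0r.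
rewrite big_cons -IH -(conn_addr conn) //; last exact: smooth_sum.
by congr (nabla _ _ _); apply/funext => q; rewrite big_cons.
Qed.

End Connection.

(** * Calculus in the left-invariant frame, and the covariant derivative of a left-invariant
    tensor *)

Section LeftInvariantFrame.
Variables (R : realType) (n : nat).
Local Notation V := 'rV[R]_n.
Variable br : {bilinear V -> V -> V}.
Hypothesis nil : two_step_nilpotent br.

(* The left Maurer-Cartan form applied to the field X. *)
Definition left_coord (X : V -> V) : V -> V :=
  fun p => X p - 2^-1 *: br p (X p).

Lemma eval2_left_inv_tensor B X Y p :
  eval2 (left_inv_tensor br B) X Y p = B (left_coord X p) (left_coord Y p).
Proof. exact: left_inv_tensorE. Qed.

(** The two shears, by plus and minus half a bracket with [p], are mutually inverse because the
    double bracket with [p] vanishes. *)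
Lemma left_coordK X p : left_inv_field br (left_coord X p) p = X p.
Proof.
rewrite left_inv_fieldE /left_coord linearBr /= linearZr_LR /= (br_brr nil).
by rewrite scaler0 subr0 subrK.
Qed.

Lemma left_inv_fieldK x : left_coord (left_inv_field br x) = fun _ => x.
Proof.
apply/funext => p; rewrite /left_coord left_inv_fieldE linearDr /= linearZr_LR.
by rewrite /= (br_brr nil) scaler0 addr0 addrK.
Qed.

Lemma left_inv_field_sum x p : left_inv_field br x p =
  \sum_(i < n) x 0 i *: left_inv_field br (delta_mx 0 i) p.
Proof.
rewrite left_inv_fieldE {1}(row_sum_delta x) {2}(row_sum_delta x).
rewrite linear_sumr scaler_sumr -big_split; apply: eq_bigr => i _.
by rewrite left_inv_fieldE linearZr_LR /= scalerDr !scalerA mulrC.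
Qed.

(** The left-invariant fields of the basis vectors form a global frame, so the connection axioms,
    which speak of function multiples of fields, reach every smooth field. *)
Lemma frame_expansion X : X = fun q =>
  \sum_(i < n) left_coord X q 0 i *: left_inv_field br (delta_mx 0 i) q.
Proof. by apply/funext => q; rewrite -left_inv_field_sum left_coordK. Qed.

Lemma smooth_brZ (X Y : V -> V) c : smooth X -> smooth Y ->
  smooth (fun p => c *: br (X p) (Y p)).
Proof.
move=> sX sY; apply: smoothZ; first exact: smooth_cst.
apply: (smooth_bilinear_rV (B := br)) => //.
- by move=> w a x y; rewrite linearDl linearZl_LR.
- by move=> u a x y; rewrite linearDr linearZr_LR.
Qed.

Lemma smooth_left_inv_field x : smooth (left_inv_field br x).
Proof.
rewrite left_inv_fieldE; apply: smoothD; first exact: smooth_cst.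
by apply: smooth_brZ; [exact: smooth_id|exact: smooth_cst].
Qed.

Lemma smooth_left_coord X : smooth X -> smooth (left_coord X).
Proof.
move=> sX.
have -> : left_coord X = fun p => X p + - 2^-1 *: br p (X p).
  by apply/funext => p; rewrite scaleNr.
by apply: smoothD => //; apply: smooth_brZ => //; exact: smooth_id.
Qed.

Variable nabla : (V -> V) -> (V -> V) -> V -> V.
Hypothesis conn : affine_connection nabla.

Let smooth_frame (c : V -> R) i : smooth c ->
  smooth (fun q => c q *: left_inv_field br (delta_mx 0 i) q).
Proof. by move=> sc; apply: smoothZ => //; exact: smooth_left_inv_field. Qed.

Lemma conn_tensorial X Y p : smooth X -> smooth Y ->
  nabla X Y p = \sum_(i < n)
    left_coord X p 0 i *: nabla (left_inv_field br (delta_mx 0 i)) Y p.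
Proof.
move=> sX sY; have sc i := smooth_coord i (smooth_left_coord sX).
rewrite {1}(frame_expansion X) conn_suml // => [|i]; last exact: smooth_frame.
apply: eq_bigr => i _.
by rewrite (conn_scalel conn (sc i)) //; exact: smooth_left_inv_field.
Qed.

(** The Leibniz rule is applied to each term of the frame expansion of [X]. The terms with
    differentiated coefficients reassemble into a left-invariant field evaluated at [p]; the others
    give the derivative of the field whose coefficients are frozen at [p]. *)
Lemma conn_frame E X p : smooth E -> smooth X ->
  nabla E X p = left_inv_field br ('D_(E p) (left_coord X) p) p +
    nabla E (left_inv_field br (left_coord X p)) p.
Proof.
move=> sE sX; have sc i := smooth_coord i (smooth_left_coord sX).
have leib (x : V -> R) i : smooth x ->
    nabla E (fun q => x q *: left_inv_field br (delta_mx 0 i) q) p =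
    dfun E x p *: left_inv_field br (delta_mx 0 i) p +
    x p *: nabla E (left_inv_field br (delta_mx 0 i)) p.
  by move=> sx; rewrite (conn_leibniz conn) //; exact: smooth_left_inv_field.
rewrite {1}(frame_expansion X) conn_sumr // => [|i]; last exact: smooth_frame.
rewrite (eq_bigr _ (fun i _ => leib _ i (sc i))) big_split /=; congr (_ + _).
  rewrite left_inv_field_sum; apply: eq_bigr => i _.
  by rewrite /dfun derive_coord //; exact: smooth_left_coord.
(* With the coefficients frozen at their values at [p], the Leibniz rule has no derivative term. *)
pose x := left_coord X p.
have -> : left_inv_field br x = fun q =>
    \sum_(i < n) x 0 i *: left_inv_field br (delta_mx 0 i) q.
  by apply/funext => q; exact: left_inv_field_sum.
rewrite conn_sumr // => [|i]; last first.
  by apply: smooth_frame; exact: smooth_cst.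
apply: eq_bigr => i _; rewrite (leib (fun=> x 0 i)); last exact: smooth_cst.
by rewrite /dfun derive_cst scale0r add0r.
Qed.

(* Only the value of the first argument at the point matters, so X may be
   replaced there by the left-invariant field E with E p = X p; in the second
   argument this costs the derivative of the coordinates of X. *)
Lemma left_coord_nabla X p : smooth X ->
  left_coord (nabla X X) p = 'D_(X p) (left_coord X) p +
    left_coord (nabla (left_inv_field br (left_coord X p))
                      (left_inv_field br (left_coord X p))) p.
Proof.
move=> sX; set x := left_coord X p; set E := left_inv_field br x.
have sE : smooth E by exact: smooth_left_inv_field.
have EX : nabla X X p = nabla E X p.
  rewrite !(conn_tensorial _ sX) // (conn_tensorial _ sE) //.
  by rewrite left_inv_fieldK.
have Ep : E p = X p by exact: left_coordK.
have := conn_frame p sE sX; rewrite -EX Ep -/x -/E => nXX.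
have cD u v : u + v - 2^-1 *: br p (u + v) =
    u - 2^-1 *: br p u + (v - 2^-1 *: br p v).
  by rewrite linearDr scalerDr opprD addrACA.
rewrite /left_coord nXX cD -!/(left_coord _ p); congr (_ + _).
by have := congr1 (@^~ p) (left_inv_fieldK ('D_(X p) (left_coord X) p)).
Qed.

Variable g : {dot V for idfun}.
Hypothesis lc : levi_civita (left_inv_tensor br g) nabla.

(** Left-invariant fields have constant inner products. Metric compatibility thus moves the
    derivative along [x] onto [y] with a minus sign, and makes the derivative of the [x] field along
    [y] orthogonal to [x]; zero torsion supplies the bracket. *)
Lemma koszul x y p :
  g (left_coord (nabla (left_inv_field br x) (left_inv_field br x)) p) y =
  - g x (br x y).
Proof.
have sx := smooth_left_inv_field x; have sy := smooth_left_inv_field y.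
have dconst Z u v :
    dfun Z (eval2 (left_inv_tensor br g) (left_inv_field br u)
                                         (left_inv_field br v)) p = 0.
  rewrite /dfun.
  have -> : eval2 (left_inv_tensor br g) (left_inv_field br u)
      (left_inv_field br v) = fun=> g u v; last exact: derive_cst.
  by apply/funext => q; rewrite eval2_left_inv_tensor !left_inv_fieldK.
have := lc_metric lc sx sx sy p; rewrite dconst !eval2_left_inv_tensor.
rewrite !left_inv_fieldK => Exxy.
have := lc_metric lc sy sx sx p; rewrite dconst !eval2_left_inv_tensor.
rewrite !left_inv_fieldK => Eyxx.
have := lc_torsion_free lc sx sy p.
rewrite (lie_bracket_left_inv nil) => tors.
have : g x (left_coord (nabla (left_inv_field br x) (left_inv_field br y)) p) -
    g x (left_coord (nabla (left_inv_field br y) (left_inv_field br x)) p) =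
    g x (br x y).
  have /(congr1 (@^~ p)) <- := left_inv_fieldK (br x y).
  rewrite -linearBr /left_coord -tors; congr (g x _).
  by rewrite linearBr scalerBr !opprD !opprK addrACA.
move: Eyxx; rewrite [g _ x]dotC => Eyxx tors'.
by lra.
Qed.

Variable S : {linear V -> V}.
Hypothesis Ssym : self_adjoint g S.

(** The derivative of the coordinates of [X] enters twice through the product rule and twice, with
    the opposite sign, through [nabla X X], so it cancels. What remains is the contribution of the
    left-invariant field agreeing with [X] at [p]. *)
Lemma cov_deriv_left_inv X p : smooth X ->
  cov_deriv nabla (left_inv_tensor br (fun x y => g (S x) y)) X X X p =
  2 * g (left_coord X p) (br (left_coord X p) (S (left_coord X p))).
Proof.
move=> sX; have sc := smooth_left_coord sX.
pose B x y := g (S x) y.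
have BC x y : B x y = B y x by rewrite /B Ssym dotC.
have Bl w : linear (B^~ w : V -> R).
  by move=> a x y; rewrite /B linearD linearZ dot_linearl.
have Br u : linear (B u : V -> R) by exact: dot_linearr.
rewrite /cov_deriv !eval2_left_inv_tensor -!/(B _ _).
have -> : dfun X (eval2 (left_inv_tensor br B) X X) p =
    2 * B ('D_(X p) (left_coord X) p) (left_coord X p).
  rewrite /dfun.
  have -> : eval2 (left_inv_tensor br B) X X =
      fun q => B (left_coord X q) (left_coord X q).
    by apply/funext => q; exact: eval2_left_inv_tensor.
  rewrite derive_bilinear_rV // BC; lra.
rewrite (BC (left_coord X p)) left_coord_nabla //.
set x := left_coord X p; set w := left_coord (nabla _ _) p.
have -> : B ('D_(X p) (left_coord X) p + w) x =
    B ('D_(X p) (left_coord X) p) x + B w x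
  by rewrite !(BC _ x) /B linearDr.
(* Self-adjointness moves [S] onto [x], and Koszul's formula is used with [S x] as the test
   vector. *)
have -> : B w x = - g x (br x (S x)) by rewrite /B Ssym koszul.
lra.
Qed.

End LeftInvariantFrame.

Theorem proposition4p1 (R : realType) (n : nat)
    (br : {bilinear 'rV[R]_n -> 'rV[R]_n -> 'rV[R]_n})
    (g : {dot 'rV[R]_n for idfun})
    (nabla : ('rV[R]_n -> 'rV[R]_n) -> ('rV[R]_n -> 'rV[R]_n) ->
             'rV[R]_n -> 'rV[R]_n)
    (S : {linear 'rV[R]_n -> 'rV[R]_n}) :
  two_step_nilpotent br ->
  levi_civita (left_inv_tensor br g) nabla ->
  self_adjoint g S ->
  killing_tensor nabla (left_inv_tensor br (fun x y => g (S x) y)) <->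
  (forall x y, orth_compl g (lie_center br) x -> orth_compl g (lie_center br) y ->
     br (S x) y = br x (S y)) /\
  (forall x, orth_compl g (lie_center br) x ->
     forall z w, lie_center br z -> lie_center br w ->
       g (br x (S z)) w = - g z (br x (S w))).
Proof.
move=> nil lc Ssym; rewrite -(killing_algebraic g nil S).
have conn := lc_connection lc.
split=> K => [x|X sX p]; last first.
  by rewrite (cov_deriv_left_inv nil conn lc Ssym) // K mulr0.
(* To recover the cubic form at [x], the Killing equation is tested on the left-invariant field of
   [x] at the neutral element 0. *)
have sx := smooth_left_inv_field br x.
have := K _ sx 0; rewrite (cov_deriv_left_inv nil conn lc Ssym) //.
by rewrite (left_inv_fieldK nil) => /eqP; rewrite mulf_eq0 pnatr_eq0 => /eqP.
Qed.
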